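(* For all integers $d\geq 0$ and $k\geq 1$, one has the identities of formal power series in $z$ $$\sum_{n=0}^\infty {\lambda_k(n)\choose d}\,z^n=\left(\prod_{j=1}^{k-1}\frac{1}{1-z^j}\right)\left(\sum_{i=0}^\infty{i\choose d}\,z^{ik}\left(\prod_{j=1}^i\frac{1}{1-z^j}\right)\right)$$ and $$\sum_{n=0}^\infty {\nu_k(n)\choose d}\,z^n=\left(\frac{z^k}{1-z^k}\right)^d\left(\prod_{j=1}^{\infty}\frac{1}{1-z^j}\right).$$
   Context: A partition of $n$ is a finite decreasing sequence $\lambda=(\lambda_1\geq\dots\geq\lambda_s>0)$ of positive integers (parts) with sum $\vert\lambda\vert=n$ (the empty partition is the unique partition of $0$). For $k\geq 1$, $\lambda_k$ denotes the $k$-th part, with $\lambda_k=0$ for $k>s$, and $\nu_k$ denotes the number of parts of $\lambda$ equal to $k$. The symbols ${\lambda_k(n)\choose d}$ and ${\nu_k(n)\choose d}$ are NOT binomial coefficients of a single number; they are notation for the sums over all partitions of $n$ $${\lambda_k(n)\choose d}=\sum_{\vert\lambda\vert=n}{\lambda_k\choose d},\qquad {\nu_k(n)\choose d}=\sum_{\vert\lambda\vert=n}{\nu_k\choose d},$$ where on the right ${m\choose d}$ is the ordinary binomial coefficient (so ${m\choose 0}=1$, including $m=0$, and ${m\choose d}=0$ for $0\le m<d$). For $k>n$ all $\lambda_k$ and $\nu_k$ equal $0$, so each partition of $n$ contributes ${0\choose d}$. Empty products equal $1$. *)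

(* Defs.v *)
From HB Require Import structures.
From mathcomp Require Import all_boot all_order all_algebra.
From mathcomp Require Import boolp.
Set Implicit Arguments.
Unset Strict Implicit.
Unset Printing Implicit Defensive.
Import GRing.Theory.
Local Open Scope ring_scope.

Record fps (R : Type) := Fps { coefs :> nat -> R }.

Lemma fpsP (R : Type) (f g : fps R) : f =1 g <-> f = g.
Proof. by split=> [|-> //]; case: f g => [f] [g] /= /funext ->. Qed.

HB.instance Definition _ (R : Type) := gen_eqMixin (fps R).
HB.instance Definition _ (R : Type) := gen_choiceMixin (fps R).

Section Ring.
Variable R : comUnitRingType.
Implicit Types f g h : fps R.

Definition fps_add f g : fps R := Fps (fun n => f n + g n).
Definition fps_opp f : fps R := Fps (fun n => - f n).
Definition fps_zero : fps R := Fps (fun _ => 0).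
Definition fps_one : fps R := Fps (fun n => (n == 0%N)%:R).
Definition fps_mul f g : fps R :=
  Fps (fun n => \sum_(i < n.+1) f i * g (n - i)%N).

Lemma fps_addA : associative fps_add.
Proof. by move=> f g h; apply/fpsP => n /=; rewrite addrA. Qed.
Lemma fps_addC : commutative fps_add.
Proof. by move=> f g; apply/fpsP => n /=; rewrite addrC. Qed.
Lemma fps_add0 : left_id fps_zero fps_add.
Proof. by move=> f; apply/fpsP => n /=; rewrite add0r. Qed.
Lemma fps_addN : left_inverse fps_zero fps_opp fps_add.
Proof. by move=> f; apply/fpsP => n /=; rewrite addNr. Qed.

HB.instance Definition _ :=
  GRing.isZmodule.Build (fps R) fps_addA fps_addC fps_add0 fps_addN.

Lemma fps_mul_poly (N : nat) f g (p q : {poly R}) :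
    (forall i, (i <= N)%N -> p`_i = f i) ->
    (forall i, (i <= N)%N -> q`_i = g i) ->
  forall i, (i <= N)%N -> (p * q)`_i = fps_mul f g i.
Proof.
move=> pf qg i iN; rewrite coefM /=; apply: eq_bigr => j _.
by rewrite pf ?qg // (leq_trans _ iN) ?leq_subr // -ltnS.
Qed.

Let trunc N f : {poly R} := \poly_(i < N.+1) f i.
Let truncE N f i : (i <= N)%N -> (trunc N f)`_i = f i.
Proof. by move=> iN; rewrite coef_poly ltnS iN. Qed.

Lemma fps_mulA : associative fps_mul.
Proof.
move=> f g h; apply/fpsP => n.
transitivity (trunc n f * (trunc n g * trunc n h))`_n; last rewrite mulrA.
  by symmetry; apply: (fps_mul_poly (@truncE n f)
    (fps_mul_poly (@truncE n g) (@truncE n h))).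
by apply: (fps_mul_poly
  (fps_mul_poly (@truncE n f) (@truncE n g)) (@truncE n h)).
Qed.

Lemma fps_mulC : commutative fps_mul.
Proof.
move=> f g; apply/fpsP => n.
transitivity (trunc n f * trunc n g)`_n; last rewrite mulrC.
  by symmetry; apply: (fps_mul_poly (@truncE n f) (@truncE n g)).
by apply: (fps_mul_poly (@truncE n g) (@truncE n f)).
Qed.

Lemma fps_mul1 : left_id fps_one fps_mul.
Proof.
move=> f; apply/fpsP => n /=.
rewrite big_ord_recl /= mul1r subn0 big1 ?addr0 // => i _.
by rewrite mul0r.
Qed.

Lemma fps_mulDl : left_distributive fps_mul fps_add.
Proof.
move=> f g h; apply/fpsP => n /=; rewrite -big_split /=.
by apply: eq_bigr => i _; rewrite mulrDl.
Qed.

Lemma fps_one_neq0 : fps_one != 0.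
Proof. by apply/eqP => /fpsP /(_ 0%N) /= /eqP; rewrite oner_eq0. Qed.

HB.instance Definition _ := GRing.Zmodule_isComNzRing.Build (fps R)
  fps_mulA fps_mulC fps_mul1 fps_mulDl fps_one_neq0.

Lemma coef_fpsD f g n : (f + g) n = f n + g n. Proof. by []. Qed.
Lemma coef_fpsN f n : (- f) n = - f n. Proof. by []. Qed.
Lemma coef_fpsB f g n : (f - g) n = f n - g n. Proof. by []. Qed.
Lemma coef_fps0 n : (0 : fps R) n = 0. Proof. by []. Qed.
Lemma coef_fps1 n : (1 : fps R) n = (n == 0%N)%:R. Proof. by []. Qed.
Lemma coef_fpsM f g n : (f * g) n = \sum_(i < n.+1) f i * g (n - i)%N.
Proof. by []. Qed.
Lemma coef_fps_sum I (r : seq I) (P : pred I) (F : I -> fps R) n :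
  (\sum_(i <- r | P i) F i) n = \sum_(i <- r | P i) F i n.
Proof. by apply: (big_morph (fun f : fps R => f n)). Qed.

Definition fpsC (c : R) : fps R := Fps (fun n => if n == 0%N then c else 0).
Definition fpsX : fps R := Fps (fun n => (n == 1%N)%:R).

Lemma coef_fpsCM c f n : (fpsC c * f) n = c * f n.
Proof.
rewrite coef_fpsM big_ord_recl /= subn0 big1 ?addr0 // => i _.
by rewrite mul0r.
Qed.

Lemma coef_fpsXM f n : (fpsX * f) n = if n is m.+1 then f m else 0.
Proof.
rewrite coef_fpsM; case: n => [|n]; first by rewrite big_ord1 /= mul0r.
rewrite big_ord_recl big_ord_recl /= mul0r add0r mul1r subn1 /= big1 ?addr0 //.
by move=> i _; rewrite mul0r.
Qed.

Lemma coef_fpsXn m n : (fpsX ^+ m) n = (n == m)%:R.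
Proof.
by elim: m n => [|m IH] [|n]; rewrite ?expr0 ?exprS ?coef_fpsXM ?IH.
Qed.

(* For a unit c = f 0, the inverse is c^-1 * \sum_i (1 - c^-1 f)^i; only the  *)
(* terms i <= n contribute to the coefficient of index n.                     *)
Definition fps_unit : pred (fps R) := fun f => f 0%N \is a GRing.unit.
Definition fps_inv f : fps R :=
  if fps_unit f then
    fpsC (f 0%N)^-1 *
      Fps (fun n => (\sum_(i < n.+1) (1 - fpsC (f 0%N)^-1 * f) ^+ i) n)
  else f.

Lemma coef_fpsX_small g m n : g 0%N = 0 -> (n < m)%N -> (g ^+ m) n = 0.
Proof.
move=> g0; elim: m n => // m IH n nm; rewrite exprS coef_fpsM big1 // => i _.
case: (posnP i) => [->|i0]; first by rewrite g0 mul0r.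
rewrite IH ?mulr0 // (leq_trans _ (nm : (n <= m)%N)) // ltn_subrL i0 /=.
by apply: leq_trans i0 _; rewrite -ltnS.
Qed.

Lemma fps_mulVr : {in fps_unit, left_inverse 1 fps_inv *%R}.
Proof.
move=> f uf; rewrite /fps_inv; have u0 : fps_unit f by [].
rewrite u0; set c := fpsC _; set g := 1 - c * f; set s := Fps _.
have g0 : g 0%N = 0 by rewrite coef_fpsB coef_fpsCM coef_fps1 /= mulVr // subrr.
have -> : c * s * f = s * (1 - g).
  by rewrite /g opprB addrCA subrr addr0 -mulrA mulrCA.
apply/fpsP => n.
have -> : (s * (1 - g)) n = ((\sum_(i < n.+1) g ^+ i) * (1 - g)) n.
  rewrite !coef_fpsM; apply: eq_bigr => i _; congr (_ * _).
  rewrite [LHS]/= !coef_fps_sum -!(big_mkord xpredT (fun j => (g ^+ j) i)).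
  rewrite [RHS](big_cat_nat (n := i.+1)) //=.
  rewrite [X in _ = _ + X]big_nat_cond [X in _ = _ + X]big1 ?addr0 //.
  by move=> j /andP[/andP[ij _] _]; rewrite coef_fpsX_small.
rewrite mulrC -opprB mulNr -subrX1 opprB coef_fpsB.
by rewrite (coef_fpsX_small g0) ?subr0.
Qed.

Lemma fps_unitPl f g : g * f = 1 -> fps_unit f.
Proof.
move=> /fpsP /(_ 0%N); rewrite coef_fpsM big_ord1 /= => gf.
by apply/unitrP; exists (g 0%N); rewrite gf mulrC gf.
Qed.

Lemma fps_inv_out : {in [predC fps_unit], fps_inv =1 id}.
Proof. by move=> f /negP nuf; rewrite /fps_inv; case: ifP. Qed.

HB.instance Definition _ := GRing.ComNzRing_hasMulInverse.Build (fps R)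
  fps_mulVr fps_unitPl fps_inv_out.

Lemma fps_unitE f : (f \is a GRing.unit) = (f 0%N \is a GRing.unit).
Proof. by []. Qed.

Lemma fps_unit_1subXn j : (0 < j)%N -> 1 - fpsX ^+ j \is a GRing.unit.
Proof.
by case: j => // j _; rewrite fps_unitE coef_fpsB coef_fpsXn subr0 unitr1.
Qed.

(* Convergence in the X-adic topology: every coefficient is eventually        *)
(* constant.                                                                  *)
Definition fps_cvg (u : nat -> fps R) (f : fps R) : Prop :=
  forall n, exists N, forall m, (N <= m)%N -> u m n = f n.

Lemma fps_cvg_unique u f g : fps_cvg u f -> fps_cvg u g -> f = g.
Proof.
move=> uf ug; apply/fpsP => n; have [N HN] := uf n; have [M HM] := ug n.
by rewrite -(HN (maxn N M)) ?leq_maxl // HM // leq_maxr.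
Qed.

End Ring.

Arguments fpsX {R}.

Local Open Scope nat_scope.

Definition is_partition (n : nat) (s : seq nat) : bool :=
  [&& sorted geq s, all (fun m => 0 < m) s & sumn s == n].

(* A partition of n has at most n parts, all of them at most n.               *)
Definition partitions (n : nat) : seq (seq nat) :=
  [seq s <- [seq map val b | b : n.-bseq 'I_n.+1] | is_partition n s].

Lemma mem_partitions n s : (s \in partitions n) = is_partition n s.
Proof.
rewrite mem_filter; case Ps: (is_partition n s) => //=.
case/and3P: Ps => _ pos /eqP sn.
have szs : size s <= n.
  rewrite -sn; elim: s pos {sn} => //= x s IH /andP[x0 /IH].
  by move=> H; rewrite -add1n leq_add.
have les : all (fun m => m <= n) s.
  apply/allP => m ms; rewrite -sn; elim: s ms {pos sn szs} => //= x s IH.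
  rewrite inE => /predU1P[->|/IH]; first exact: leq_addr.
  by move=> /leq_trans; apply; exact: leq_addl.
have szb : size (map (@inord n) s) <= n by rewrite size_map.
apply/mapP; exists (Bseq szb); rewrite ?mem_enum //= -map_comp.
rewrite -[LHS]map_id; apply/eq_in_map => m ms /=.
by rewrite inordK // ltnS (allP les).
Qed.

Lemma partitions_uniq n : uniq (partitions n).
Proof.
rewrite filter_uniq // map_inj_uniq ?enum_uniq // => b c bc.
by apply: val_inj; apply: inj_map bc; exact: val_inj.
Qed.

(* Parts are numbered from 1.                                                 *)
Definition part (s : seq nat) (k : nat) : nat := nth 0 s k.-1.
Definition mult (s : seq nat) (k : nat) : nat := count_mem k s.

Definition part_binom (k d n : nat) : nat :=
  \sum_(s <- partitions n) 'C(part s k, d).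

Definition mult_binom (k d n : nat) : nat :=
  \sum_(s <- partitions n) 'C(mult s k, d).

(* Main.v *)
Require Import Defs.
From mathcomp Require Import all_boot all_order all_algebra.
From mathcomp Require Import boolp zify.
Set Implicit Arguments.
Unset Strict Implicit.
Unset Printing Implicit Defensive.
Import GRing.Theory.
Local Open Scope ring_scope.

(** Weights on partitions are turned into power series by
    pgf w = \sum_n (\sum_(|s| = n) w s) z^n, and two bijections do all the work.

    Inserting a part k is a bijection from the partitions of n - k to the
    partitions of n that contain k; so, for a weight w supported on partitions
    containing k, pgf w = z^k pgf (fun s => w (k :: s)) (pgf_remove_part).
    Conjugation preserves size and exchanges the part s_(K+1) with the number
    of parts > K (pgf_conj).  Each product formula comes from an equation
    f = g + z^j f, that is, f = g / (1 - z^j) (fps_geometric).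

    Multiplicities.  Pascal's rule C(m + 1, d + 1) = C(m, d + 1) + C(m, d)
    under insertion of k gives F_(d+1) = z^k (F_(d+1) + F_d) for
    F_d = pgf C(nu_k, d), hence F_d = (z^k / (1 - z^k))^d F_0; and F_0 counts
    all partitions, the limit of the counts of partitions with parts <= N
    (pgf_le).

    Parts.  Since C(s_k, d) = \sum_i C(i, d) [s_k = i], it suffices to find
    A_i, the series of partitions with s_k = i, namely
    A_i = z^(ik) \prod_(j < k) 1/(1 - z^j) \prod_(j <= i) 1/(1 - z^j)
    (pgf_part_eq).  Conjugation turns A_0 into the series of partitions with
    all parts < k.  The partitions with s_k = i + 1 are of two kinds: if
    s_(k+1) = i + 1 too, removing a part i + 1 leaves any partition with
    s_k = i + 1 (pgf_part_repeated); otherwise, the conjugate contains k, and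
    removing it there leaves any partition with s_k = i (pgf_part_drop).  So
    A_(i+1) = z^(i+1) A_(i+1) + z^k A_i. *)

(** * Power series *)

Lemma coef_fpsXnM (R : comUnitRingType) m (f : fps R) n :
  (fpsX ^+ m * f) n = if (m <= n)%N then f (n - m)%N else 0.
Proof.
elim: m n => [|m IH] n; first by rewrite expr0 mul1r subn0.
rewrite exprS -mulrA coef_fpsXM; by case: n => [|n] //; exact: IH.
Qed.

(** A coefficient of g * u N involves only finitely many coefficients of u N,
    so a common index past which all of them are stable exists. *)
Lemma fps_cvg_mull (R : comUnitRingType) (g : fps R) u f :
  fps_cvg u f -> fps_cvg (fun N => g * u N) (g * f).
Proof.
move=> uf n.
have [N uN] : exists N, forall m i, (N <= m)%N -> (i <= n)%N -> u m i = f i.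
  elim: n => [|n [N uN]].
    have [N uN] := uf 0%N; exists N => m i Nm.
    by rewrite leqn0 => /eqP->; exact: uN.
  have [M uM] := uf n.+1; exists (maxn N M) => m i.
  rewrite geq_max => /andP[Nm Mm]; rewrite leq_eqVlt => /predU1P[->|].
    exact: uM.
  exact: uN.
exists N => m Nm; rewrite !coef_fpsM; apply: eq_bigr => i _.
by rewrite uN // leq_subr.
Qed.

Lemma fps_geometric (R : comUnitRingType) j (f g : fps R) : (0 < j)%N ->
  f = g + fpsX ^+ j * f -> f = 1 / (1 - fpsX ^+ j) * g.
Proof.
move=> j0 fg; have u := fps_unit_1subXn R j0.
have -> : g = (1 - fpsX ^+ j) * f by rewrite mulrBl mul1r {1}fg addrK.
by rewrite mulrA div1r mulVr // mul1r.
Qed.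

(** * Partitions: conjugation, and insertion of a part *)

Lemma geq_total : total geq.
Proof. by move=> x y; rewrite /= orbC leq_total. Qed.

Lemma geq_transitive : transitive geq.
Proof. by move=> x y z /= yx xz; exact: leq_trans xz yx. Qed.

Lemma geq_antisym : antisymmetric geq.
Proof. by move=> x y /=; rewrite andbC => /anti_leq. Qed.

(** Both sides say that the cell in row k, column j (numbered from 0) lies in
    the Young diagram of s; this is what makes conjugation an involution. *)
Lemma count_gt_nth s j k : sorted geq s ->
  (k < count (ltn j) s)%N = (j < nth 0%N s k)%N.
Proof.
elim: s k => [|x s IH] k; first by rewrite nth_nil.
move=> /= xs; have ss := path_sorted xs.
have /allP sx : all (geq x) s by exact: order_path_min geq_transitive xs.
case: (ltnP j x) => jx.
  by case: k => [|k] //; rewrite add1n ltnS IH.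
have s0 y : y \in s -> (y <= j)%N by move=> /sx /= yx; exact: leq_trans jx.
have -> : count (ltn j) s = 0%N.
  by apply/eqP; rewrite -leqn0 leqNgt -has_count; apply/hasPn => y /s0;
    rewrite /= -leqNgt.
rewrite /= ltn0; case: k => [|k] /=; first by rewrite ltnNge jx.
have [ks|sk] := ltnP k (size s); last by rewrite nth_default.
by rewrite ltnNge s0 // mem_nth.
Qed.

Lemma count_gtS s j :
  count (ltn j) s = (count_mem j.+1 s + count (ltn j.+1) s)%N.
Proof. by elim: s => //= x s ->; lia. Qed.

Lemma eq_from_nth_pos s t :
  all (fun m => 0 < m)%N s -> all (fun m => 0 < m)%N t ->
  nth 0%N s =1 nth 0%N t -> s = t.
Proof.
move=> /all_nthP s0 /all_nthP t0 st.
have st_size : size s = size t.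
  apply/eqP; rewrite eqn_leq; apply/andP; split; rewrite leqNgt; apply/negP => lt.
    by have := s0 0%N _ lt; rewrite st nth_default.
  by have := t0 0%N _ lt; rewrite -st nth_default.
by apply: (@eq_from_nth _ 0%N) => // i _; exact: st.
Qed.

Definition conj_part (s : seq nat) : seq nat :=
  mkseq (fun j => count (ltn j) s) (head 0%N s).

Lemma nth_conj_part s j : sorted geq s ->
  nth 0%N (conj_part s) j = count (ltn j) s.
Proof.
move=> ss; have [jh|hj] := ltnP j (head 0%N s); first by rewrite nth_mkseq.
rewrite nth_default ?size_mkseq //; apply/esym/eqP.
by rewrite -leqn0 leqNgt count_gt_nth // nth0 -leqNgt.
Qed.

Lemma sorted_conj_part s : sorted geq s -> sorted geq (conj_part s).
Proof.
move=> ss; apply/(sortedP 0%N) => i _; rewrite !nth_conj_part //=.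
by rewrite [leqRHS]count_gtS leq_addl.
Qed.

Lemma pos_conj_part s :
  sorted geq s -> all (fun m => 0 < m)%N (conj_part s).
Proof.
move=> ss; apply/(all_nthP 0%N) => i; rewrite size_mkseq => ih.
by rewrite nth_conj_part // count_gt_nth // nth0.
Qed.

Lemma count_ltn_iota a n :
  (a <= n)%N -> count (fun j => j < a)%N (iota 0 n) = a.
Proof.
move=> an; rewrite -(subnKC an) iotaD count_cat add0n.
rewrite (eq_in_count (a2 := xpredT)); last by move=> j; rewrite mem_iota.
rewrite count_predT size_iota (eq_in_count (a2 := pred0)) ?count_pred0 ?addn0 //.
by move=> j; rewrite mem_iota => /andP[aj _]; rewrite ltnNge aj.
Qed.

Lemma count_conj_part s j : sorted geq s ->
  count (ltn j) (conj_part s) = nth 0%N s j.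
Proof.
move=> ss; rewrite count_map.
rewrite (eq_count (a2 := fun i => (i < nth 0 s j)%N)) => [|i]; last first.
  by rewrite /= count_gt_nth.
apply: count_ltn_iota; case: s ss => [|x s] /= xs; first by rewrite nth_nil.
case: j => //= j; have [js|sj] := ltnP j (size s); last by rewrite nth_default.
by have /allP/(_ _ (mem_nth 0%N js)) := order_path_min geq_transitive xs.
Qed.

Lemma conj_partK s : sorted geq s -> all (fun m => 0 < m)%N s ->
  conj_part (conj_part s) = s.
Proof.
move=> ss s0; have cs := sorted_conj_part ss.
apply: eq_from_nth_pos => // [|j]; first exact: pos_conj_part.
by rewrite nth_conj_part // count_conj_part.
Qed.

(** Double counting of the cells of the Young diagram. *)
Lemma sumn_conj_part s : sorted geq s -> sumn (conj_part s) = sumn s.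
Proof.
move=> ss; have hs x : x \in s -> (x <= head 0 s)%N.
  case: s ss => //= y s ys; rewrite inE => /predU1P[->//|].
  exact: (allP (order_path_min geq_transitive ys)).
rewrite !sumnE big_map; under eq_bigr do rewrite -sum1_count big_mkcond.
rewrite exchange_big; apply: eq_big_seq => x /hs xh.
by rewrite -big_mkcond sum1_count count_ltn_iota.
Qed.

Lemma is_partition_conj n s : is_partition n s -> is_partition n (conj_part s).
Proof.
case/and3P => ss s0 sn; apply/and3P; split.
- exact: sorted_conj_part.
- exact: pos_conj_part.
- by rewrite sumn_conj_part.
Qed.

Lemma perm_partitions_conj n :
  perm_eq (partitions n) (map conj_part (partitions n)).
Proof.
apply: uniq_perm; first exact: partitions_uniq.
  rewrite map_inj_in_uniq ?partitions_uniq // => s t.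
  rewrite !mem_partitions => /and3P[ss s0 _] /and3P[ts t0 _] st.
  by rewrite -[s]conj_partK // st conj_partK.
move=> s; apply/idP/mapP => [|[t + ->]]; rewrite !mem_partitions.
  move=> sn; exists (conj_part s).
    by rewrite mem_partitions is_partition_conj.
  by case/and3P: sn => *; rewrite conj_partK.
exact: is_partition_conj.
Qed.

Lemma is_partition_sort_cons n k s : (0 < k <= n)%N ->
  is_partition (n - k) s -> is_partition n (sort geq (k :: s)).
Proof.
case/andP => k0 kn /and3P[ss s0 /eqP sn]; apply/and3P; split.
- exact: sort_sorted geq_total _.
- by rewrite all_sort /= k0.
- have /perm_sumn -> : perm_eq (sort geq (k :: s)) (k :: s) by rewrite perm_sort.
  by rewrite /= sn subnKC.
Qed.

(** Since a partition is determined by its multiset of parts, removing one copy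
    of k inverts the insertion of k. *)
Lemma perm_partitions_mem n k : (0 < k <= n)%N ->
  perm_eq [seq s <- partitions n | k \in s]
    [seq sort geq (k :: s) | s <- partitions (n - k)].
Proof.
move=> kn; apply: uniq_perm; first by rewrite filter_uniq // partitions_uniq.
  rewrite map_inj_in_uniq ?partitions_uniq // => s t.
  rewrite !mem_partitions => /and3P[ss _ _] /and3P[ts _ _] st.
  apply: (sorted_eq geq_transitive geq_antisym ss ts).
  by rewrite -(perm_cons k) -(perm_sort geq) st perm_sort.
move=> s; rewrite mem_filter mem_partitions; apply/andP/mapP => [[ks]|].
  case/and3P => ss s0 /eqP sn; have ps := perm_to_rem ks.
  exists (rem k s).
    rewrite mem_partitions; apply/and3P; split.
    - exact: subseq_sorted geq_transitive _ _ (rem_subseq _ _) ss.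
    - by apply/allP => x /mem_rem; exact: (allP s0).
    - by have := perm_sumn ps; rewrite sn /= => ->; rewrite addKn.
  apply: (sorted_eq geq_transitive geq_antisym ss).
    exact: sort_sorted geq_total _.
  by rewrite (perm_trans ps) // perm_sym perm_sort.
case=> t; rewrite mem_partitions => tn ->.
by rewrite mem_sort mem_head is_partition_sort_cons.
Qed.

(** * Generating functions over partitions *)

Definition pgf (w : seq nat -> nat) : fps int :=
  Fps (fun n => (\sum_(s <- partitions n) w s)%N%:Z).

Lemma eq_pgf w1 w2 :
  (forall s, sorted geq s -> all (fun m => 0 < m)%N s -> w1 s = w2 s) ->
  pgf w1 = pgf w2.
Proof.
move=> w12; apply/fpsP => n; congr Posz; apply: eq_big_seq => s.
by rewrite mem_partitions => /and3P[ss s0 _]; exact: w12.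
Qed.

Lemma pgfD w1 w2 : pgf (fun s => w1 s + w2 s)%N = pgf w1 + pgf w2.
Proof. by apply/fpsP => n; rewrite coef_fpsD /= big_split. Qed.

Lemma pgfZ c w : pgf (fun s => c * w s)%N = c%:R * pgf w.
Proof.
rewrite mulr_natl; elim: c => [|c IH].
  by apply/fpsP => n; rewrite /= big1.
by rewrite mulrS -IH -pgfD; apply: eq_pgf => s _ _; rewrite mulSn.
Qed.

Lemma pgf_sum N (w : nat -> seq nat -> nat) :
  pgf (fun s => \sum_(0 <= i < N) w i s)%N = \sum_(0 <= i < N) pgf (w i).
Proof.
elim: N => [|N IH].
  rewrite big_geq //; apply/fpsP => n; rewrite /= big1 // => s _.
  by rewrite big_geq.
rewrite big_nat_recr //= -IH -pgfD; apply: eq_pgf => s _ _.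
by rewrite big_nat_recr.
Qed.

Lemma pgf_conj w : pgf w = pgf (fun s => w (conj_part s)).
Proof.
apply/fpsP => n; congr Posz.
by rewrite [LHS](perm_big _ (perm_partitions_conj n)) big_map.
Qed.

(** Invariance of w under permutations lets the new part be put in front,
    whereas in the partition itself it has to be sorted into place. *)
Lemma pgf_mem k w : (0 < k)%N -> (forall s t, perm_eq s t -> w s = w t) ->
  pgf (fun s => (k \in s) * w s)%N = fpsX ^+ k * pgf (fun s => w (k :: s)).
Proof.
move=> k0 wP; apply/fpsP => n; rewrite coef_fpsXnM /=.
under eq_bigr do rewrite mulnbl.
rewrite -big_mkcond -big_filter; case: leqP => [kn|nk].
  rewrite (perm_big _ (perm_partitions_mem _)) ?k0 // big_map.
  by congr Posz; apply: eq_bigr => s _; apply: wP; rewrite perm_sort.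
rewrite big_filter big_seq_cond big1 // => s /andP[].
rewrite mem_partitions => /and3P[_ _ /eqP sn] ks; exfalso.
by have := perm_sumn (perm_to_rem ks); rewrite sn /=; lia.
Qed.

(** The form of pgf_mem in which it is applied: w is already supported on the
    partitions containing k. *)
Lemma pgf_remove_part k w v : (0 < k)%N ->
  (forall s t, perm_eq s t -> w s = w t) ->
  (forall s, w (k :: s) = v s) ->
  (forall s, sorted geq s -> k \notin s -> w s = 0)%N ->
  pgf w = fpsX ^+ k * pgf v.
Proof.
move=> k0 wP wv w0; have -> : pgf v = pgf (fun s => w (k :: s)).
  by apply: eq_pgf => s _ _; rewrite wv.
rewrite -pgf_mem //; apply: eq_pgf => s ss _.
by case: (boolP (k \in s)) => [|/(w0 _ ss)->]; rewrite ?mul1n ?muln0.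
Qed.

Local Notation euler N :=
  (\prod_(1 <= j < N.+1) (1 / (1 - fpsX ^+ j)) : fps int).

(** A partition with parts at most N + 1 either has parts at most N, or
    contains N + 1, which may then be removed. *)
Lemma pgf_le N : pgf (fun s => all (fun m => m <= N)%N s) = euler N.
Proof.
elim: N => [|N IH].
  rewrite big_geq //; apply/fpsP => n; rewrite coef_fps1 /=.
  under eq_big_seq => s.
    rewrite mem_partitions => /and3P[_ s0 _].
    have -> : all (fun m => m <= 0)%N s = (s == [::]).
      by case: s s0 => //= x s /andP[x0 _]; rewrite leqNgt x0.
    over.
  rewrite (eq_bigr (fun s => if s == [::] then 1 else 0)%N); last first.
    by move=> s _; case: eqP.
  rewrite -big_mkcond sum1_count count_uniq_mem ?partitions_uniq //.
  by rewrite mem_partitions /is_partition /= eq_sym; case: eqP.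
rewrite big_nat_recr //= -IH mulrC; apply: fps_geometric => //.
rewrite -(@pgf_remove_part N.+1
  (fun s => (N.+1 \in s) * all (fun m => m <= N.+1)%N s)%N) //.
- rewrite -pgfD; apply: eq_pgf => s _ _.
  case: (boolP (N.+1 \in s)) => [Ns|Ns].
    rewrite mul1n; case: (boolP (all (fun m => m <= N)%N s)) => // /allP.
    by move=> /(_ _ Ns); rewrite ltnn.
  rewrite mul0n addn0; congr nat_of_bool; apply: eq_in_all => x xs /=.
  by rewrite leq_eqVlt ltnS; case: eqP => // xN; rewrite -xN xs in Ns.
- by move=> s t st; rewrite (perm_mem st) (perm_all _ st).
- by move=> s; rewrite mem_head mul1n /= leqnn.
- by move=> s _ /negPf->.
Qed.

(** After conjugation: no part exceeds K. *)
Lemma pgf_part0 K :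
  pgf (fun s => nth 0%N s K == 0%N) = euler K.
Proof.
rewrite -pgf_le pgf_conj; apply: eq_pgf => s ss s0.
rewrite nth_conj_part // -leqn0 leqNgt -has_count -all_predC.
by congr nat_of_bool; apply: eq_all => x /=; rewrite -leqNgt.
Qed.

(** Rewrites a condition on positions, hard to follow through an insertion, as
    one on counts, which does not depend on the order of the parts. *)
Lemma nth_eqS s K i : sorted geq s ->
  (nth 0%N s K == i.+1) =
  (K < count (ltn i) s)%N && (count (ltn i.+1) s <= K)%N.
Proof. by move=> ss; rewrite [X in _ && X]leqNgt !count_gt_nth //; lia. Qed.

Lemma perm_count_gt s t j : perm_eq s t -> count (ltn j) s = count (ltn j) t.
Proof. by move=> /seq.permP. Qed.

(** Removing one of the parts i + 1 at positions K and K + 1 (numbered from 0)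
    shifts up the parts below it and leaves i + 1 at position K. *)
Lemma pgf_part_repeated (K i : nat) :
  pgf (fun s => (nth 0%N s K == i.+1) && (nth 0%N s K.+1 == i.+1))
  = fpsX ^+ i.+1 * pgf (fun s => nth 0%N s K == i.+1).
Proof.
have -> : pgf (fun s => nth 0%N s K == i.+1) = pgf (fun s =>
    (K < count (ltn i) s)%N && (count (ltn i.+1) s <= K)%N).
  by apply: eq_pgf => s ss _; rewrite nth_eqS.
transitivity (pgf (fun s =>
    (K.+1 < count (ltn i) s)%N && (count (ltn i.+1) s <= K)%N)).
  by apply: eq_pgf => s ss _; rewrite !nth_eqS //; lia.
apply: pgf_remove_part => // [s t st|s|s ss /count_memPn s0].
- by rewrite !(perm_count_gt _ st).
- by rewrite /= ltnSn ltnn.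
- by rewrite (count_gtS s i) s0; lia.
Qed.

(** A strict descent after position K means that the conjugate has a part
    K + 1; removing it lowers by one each of the first K + 1 parts. *)
Lemma pgf_part_drop (K i : nat) :
  pgf (fun s => (nth 0%N s K == i.+1) && (nth 0%N s K.+1 <= i)%N)
  = fpsX ^+ K.+1 * pgf (fun s => nth 0%N s K == i).
Proof.
rewrite pgf_conj [in RHS]pgf_conj.
have -> : pgf (fun s => nth 0%N (conj_part s) K == i) =
    pgf (fun s => count (ltn K) s == i).
  by apply: eq_pgf => s ss _; rewrite nth_conj_part.
transitivity (pgf (fun s =>
    (count (ltn K) s == i.+1) && (count (ltn K.+1) s <= i)%N)).
  by apply: eq_pgf => s ss _; rewrite !nth_conj_part.
apply: pgf_remove_part => // [s t st|s|s ss /count_memPn s0].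
- by rewrite !(perm_count_gt _ st).
- by rewrite /= ltnSn ltnn (count_gtS s K); lia.
- by rewrite (count_gtS s K) s0; lia.
Qed.

(** The two cases of the induction step are whether the part after position K
    is again i + 1 or smaller. *)
Lemma pgf_part_eq (K i : nat) :
  pgf (fun s => nth 0%N s K == i) = fpsX ^+ (i * K.+1) * euler K * euler i.
Proof.
elim: i => [|i IH].
  rewrite pgf_part0 mul0n expr0 mul1r.
  by rewrite [X in _ = _ * X]big_geq ?mulr1.
have step : pgf (fun s => nth 0%N s K == i.+1) =
    1 / (1 - fpsX ^+ i.+1) * (fpsX ^+ K.+1 * pgf (fun s => nth 0%N s K == i)).
  apply: fps_geometric => //.
  rewrite -pgf_part_repeated -pgf_part_drop -pgfD; apply: eq_pgf => s ss _.
  have : (nth 0 s K.+1 <= nth 0 s K)%N.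
    have [Ks|sK] := ltnP K.+1 (size s); last by rewrite (nth_default _ sK).
    by move/(sortedP 0%N): ss; exact.
  by lia.
have -> : euler i.+1 = euler i * (1 / (1 - fpsX ^+ i.+1)).
  by rewrite big_nat_recr.
by rewrite step IH mulSn exprD [LHS]mulrC !mulrA.
Qed.

(** Pascal's rule, read on the insertion of a part k. *)
Lemma pgf_mult_binom k d : (0 < k)%N ->
  pgf (fun s => 'C(mult s k, d))
  = (fpsX ^+ k / (1 - fpsX ^+ k)) ^+ d * pgf (fun=> 1%N).
Proof.
move=> k0; elim: d => [|d IH].
  by rewrite expr0 mul1r; apply: eq_pgf => s _ _; rewrite bin0.
rewrite exprS -mulrA -IH [fpsX ^+ k / _]mulrC -mulrA -[_^-1]div1r.
apply: fps_geometric => //; rewrite -mulrDr -pgfD.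
apply: pgf_remove_part => // [s t /seq.permP st|s|s ss ks].
- by rewrite /mult st.
- by rewrite /mult /= eqxx binS addnC.
- by rewrite /mult (count_memPn ks).
Qed.

Theorem proposition1p5 (d k : nat) (hk : (1 <= k)%N) :
  (exists2 S : fps int,
      fps_cvg (fun N : nat =>
        \sum_(0 <= i < N) ('C(i, d)%:R * fpsX ^+ (i * k)
                           * \prod_(1 <= j < i.+1) (1 / (1 - fpsX ^+ j)))) S
    & Fps (fun n : nat => (part_binom k d n)%:Z)
        = (\prod_(1 <= j < k) (1 / (1 - fpsX ^+ j))) * S)
  /\
  (exists2 P : fps int,
      fps_cvg (fun N : nat =>
        \prod_(1 <= j < N.+1) (1 / (1 - fpsX ^+ j))) P
    & Fps (fun n : nat => (mult_binom k d n)%:Z)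
        = (fpsX ^+ k / (1 - fpsX ^+ k)) ^+ d * P).
Proof.
case: k hk => // K _; split.
  have uP : euler K \is a GRing.unit.
    rewrite big_seq rpred_prod // => j; rewrite mem_index_iota => /andP[j0 _].
    by rewrite div1r unitrV fps_unit_1subXn.
  (* Dividing the wanted identity by the unit euler K yields the only possible
     limit; the partial sums are (euler K)^-1 times t N, and t N converges
     because C(s_K, d) is the sum over i of C(i, d) [s_K = i]. *)
  exists ((euler K)^-1 * pgf (fun s => 'C(nth 0%N s K, d))); last first.
    by rewrite mulrA mulrV // mul1r.
  pose t N := pgf (fun s => \sum_(0 <= i < N) 'C(i, d) * (nth 0%N s K == i))%N.
  suff tcvg : fps_cvg t (pgf (fun s => 'C(nth 0%N s K, d))).
    have := fps_cvg_mull (euler K)^-1 tcvg.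
    congr fps_cvg; apply/funext => N; rewrite /t pgf_sum mulr_sumr.
    apply: eq_bigr => i _; rewrite pgfZ pgf_part_eq.
    by rewrite -!mulrA mulrCA; congr (_ * _); rewrite mulrCA mulKr.
  move=> n; exists n.+1 => m nm; congr Posz; apply: eq_big_seq => s.
  rewrite mem_partitions => /and3P[_ _ /eqP sn].
  have sm : (nth 0 s K < m)%N.
    apply: leq_trans nm; rewrite ltnS -sn.
    have [Ks|sK] := ltnP K (size s); last by rewrite nth_default.
    by rewrite (perm_sumn (perm_to_rem (mem_nth 0%N Ks))) leq_addr.
  (* m > n exceeds every part, so the truncated sum already meets s_K. *)
  rewrite big_mkord (bigD1 (Ordinal sm)) //= eqxx muln1 big1 ?addn0 //.
  by move=> i; rewrite -val_eqE /= eq_sym => /negPf->; rewrite muln0.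
exists (pgf (fun=> 1%N)); last exact: pgf_mult_binom.
move=> n; exists n => m nm; rewrite -pgf_le; congr Posz.
apply: eq_big_seq => s; rewrite mem_partitions => /and3P[_ _ /eqP sn].
suff -> : all (fun x => x <= m)%N s by [].
apply/allP => x xs; apply: leq_trans nm; rewrite -sn.
by rewrite (perm_sumn (perm_to_rem xs)) leq_addr.
Qed.
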